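(* Let $(z_1,w)\in R_\delta=[-1,1]\times[-1+\delta,1-\delta]$ with $\delta=0.0001$, and let $\epsilon=\frac{2\beta}{b^2}<0.9$, so that $b^2>\frac{20\beta}{9}$, which corresponds to $\lambda>1.054\,\lambda_{\text{thres}}$. Then the period of oscillations $T(\epsilon)$ is bounded by $$T(\epsilon)<T_{\text{upp}}=21.95\left(\frac{RI_3\gamma(\alpha+1-\gamma)}{b}\right).$$
   Context: The constants $m,g,R,I_1,I_3$ are positive real numbers ($g$ without argument is the gravitational acceleration), $0<\alpha<1$, $\gamma=I_1/I_3$, and it is assumed that $1-\alpha^2<\gamma<1$ and that $\sigma:=mR^2/I_3$ satisfies $\sigma=\frac{1-\gamma}{\gamma+\alpha^2-1}$. The real number $\lambda>0$ is the value of Jellett's integral; its threshold value is $$\lambda_{\text{thres}}=\frac{\sqrt{mgR^3I_3\alpha}\,(1+\alpha)^2}{\sqrt{1+\alpha-\gamma}},$$ and it is assumed throughout that $\lambda$ is above the threshold, i.e. $\lambda=C\lambda_{\text{thres}}$ with $C>1$. The number $D$ is real. The effective potential is, for $z\in(-1,1)$, $$V(z,D,\lambda)=mgR(1-\alpha z)+\frac{\big(\lambda(\alpha-(1-\gamma)z)+RD\sqrt{\gamma+\alpha^2-1}\,(\alpha-z)\big)^2}{2I_3R^2\gamma^2(\gamma+\alpha^2-1)(1-z^2)}+\frac{R^2D^2(\gamma+\alpha^2-1)-(1-\gamma)\lambda^2}{2R^2I_1(\gamma+\alpha^2-1)},$$ and the function $g(\cdot)$ (with an argument) is $$g(z)=\frac{I_3\big(\alpha^2+(1-\gamma)^2-2\alpha(1-\gamma)z\big)}{2(\gamma+\alpha^2-1)}.$$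 Put $$D_0=\frac{\lambda}{R(1-\alpha)}\frac{\alpha-1+\gamma}{\sqrt{\gamma+\alpha^2-1}},\qquad D_1=-\frac{\lambda}{R(1+\alpha)}\frac{\alpha+1-\gamma}{\sqrt{\gamma+\alpha^2-1}},$$ $$a=-(1-\gamma)\lambda-RD\sqrt{\gamma+\alpha^2-1},\qquad b=\alpha\lambda+\alpha RD\sqrt{\gamma+\alpha^2-1},\qquad w=\frac ab,$$ $$\beta=2mgR^3\alpha I_3\gamma^2(\gamma+\alpha^2-1).$$ It is assumed that $D\in(D_1,D_0)$, so that $b>0$ and $|w|<1$; then $V(\cdot,D,\lambda)$ is convex on $(-1,1)$, tends to $+\infty$ at $z=\pm1$, and has a unique minimum point $z_{\min}\in(-1,1)$. (Under these assumptions, $\lambda=C\lambda_{\text{thres}}$ gives $\epsilon=2\beta/b^2<1/C^2$.) For $\tilde E>V(z_{\min},D,\lambda)$ the turning points $z_1<z_2$ in $(-1,1)$ are the two solutions of $\tilde E=V(z,D,\lambda)$; thus $z_1$ is the left turning point. The period of oscillations within the potential, regarded as a function of $\epsilon=2\beta/b^2$, $w$ and $z_1$, is $$T(\epsilon)=2\int_{z_1}^{z_2}\frac{\sqrt{g(z)}\,dz}{\sqrt{(1-z^2)(\tilde E-V(z,D,\lambda))}}.$$ *)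

(* Defs.v *)
From HB Require Import structures.
From mathcomp Require Import all_boot all_order all_algebra.
From mathcomp Require Import all_classical all_reals all_analysis.
Set Implicit Arguments.
Unset Strict Implicit.
Unset Printing Implicit Defensive.
Import Order.TTheory GRing.Theory Num.Theory.
Local Open Scope classical_set_scope.
Local Open Scope ring_scope.

(* Tippe top in the real field K: mass m, gravitational acceleration g, radius
   R, moments of inertia I1 and I3, and alpha, the distance from the geometric
   centre to the centre of mass in units of R. *)
Record tippe_top (K : realType) := TippeTop {
  mass : K; grav : K; toprad : K; I1 : K; I3 : K; alpha : K }.

Definition gamma (K : realType) (p : tippe_top K) : K := I1 p / I3 p.

Definition sigma (K : realType) (p : tippe_top K) : K :=
  mass p * toprad p ^+ 2 / I3 p.

(* gamma + alpha^2 - 1, the quantity occurring in most formulas below. *)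
Definition kappa (K : realType) (p : tippe_top K) : K :=
  gamma p + alpha p ^+ 2 - 1.

Definition lambda_thres (K : realType) (p : tippe_top K) : K :=
  Num.sqrt (mass p * grav p * toprad p ^+ 3 * I3 p * alpha p)
    * (1 + alpha p) ^+ 2 / Num.sqrt (1 + alpha p - gamma p).

(* The effective potential; it is meant for -1 < z < 1. *)
Definition V (K : realType) (p : tippe_top K) (z D lambda : K) : K :=
  mass p * grav p * toprad p * (1 - alpha p * z)
  + (lambda * (alpha p - (1 - gamma p) * z)
     + toprad p * D * Num.sqrt (kappa p) * (alpha p - z)) ^+ 2
    / (2 * I3 p * toprad p ^+ 2 * gamma p ^+ 2 * kappa p * (1 - z ^+ 2))
  + (toprad p ^+ 2 * D ^+ 2 * kappa p - (1 - gamma p) * lambda ^+ 2)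
    / (2 * toprad p ^+ 2 * I1 p * kappa p).

(* The function g(z), not to be confused with the acceleration grav p. *)
Definition gfun (K : realType) (p : tippe_top K) (z : K) : K :=
  I3 p * (alpha p ^+ 2 + (1 - gamma p) ^+ 2 - 2 * alpha p * (1 - gamma p) * z)
  / (2 * kappa p).

Definition D0 (K : realType) (p : tippe_top K) (lambda : K) : K :=
  lambda / (toprad p * (1 - alpha p))
  * ((alpha p - 1 + gamma p) / Num.sqrt (kappa p)).

Definition D1 (K : realType) (p : tippe_top K) (lambda : K) : K :=
  - (lambda / (toprad p * (1 + alpha p))
     * ((alpha p + 1 - gamma p) / Num.sqrt (kappa p))).

Definition acoef (K : realType) (p : tippe_top K) (D lambda : K) : K :=
  - ((1 - gamma p) * lambda) - toprad p * D * Num.sqrt (kappa p).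

Definition bcoef (K : realType) (p : tippe_top K) (D lambda : K) : K :=
  alpha p * lambda + alpha p * toprad p * D * Num.sqrt (kappa p).

Definition wcoef (K : realType) (p : tippe_top K) (D lambda : K) : K :=
  acoef p D lambda / bcoef p D lambda.

Definition beta (K : realType) (p : tippe_top K) : K :=
  2 * mass p * grav p * toprad p ^+ 3 * alpha p * I3 p * gamma p ^+ 2 * kappa p.

Definition epsilon (K : realType) (p : tippe_top K) (D lambda : K) : K :=
  2 * beta p / bcoef p D lambda ^+ 2.

Definition is_minimum_point (K : realType) (p : tippe_top K)
    (D lambda zmin : K) : Prop :=
  -1 < zmin < 1 /\
  forall z : K, -1 < z < 1 -> V p zmin D lambda <= V p z D lambda.

(* z1 is the left turning point and z2 the right one. *)
Definition turning_points (K : realType) (p : tippe_top K)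
    (D lambda E z1 z2 : K) : Prop :=
  [/\ -1 < z1, z1 < z2, z2 < 1 &
      forall z : K, -1 < z < 1 ->
        (E = V p z D lambda <-> z = z1 \/ z = z2)].

(* The integrand is nonnegative and unbounded at both turning points; the
   improper integral is the Lebesgue integral over the open interval, valued in
   [0, +oo], so that an upper bound on the period includes convergence. *)
Definition period (K : realType) (p : tippe_top K)
    (D lambda E z1 z2 : K) : \bar K :=
  (2%:E * \int[lebesgue_measure]_(z in `]z1, z2[)
     (Num.sqrt (gfun p z)
      / Num.sqrt ((1 - z ^+ 2) * (E - V p z D lambda)))%:E)%E.

Definition R_delta (K : realType) (delta : K) : set (K * K) :=
  `[-1, 1] `*` `[-1 + delta, 1 - delta].

(* Main.v *)
(* Put N = 2 I3 R^2 gamma^2 kappa.  Then N (1 - z^2) (E - V z) is the cubic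
   (1 - z^2) (e + beta z) - (b + a z)^2, which vanishes at z1 and z2 and hence
   equals (z - z1) (z2 - z) F z with
   F z = (a^2 + b^2 + 2 a b z1) / (1 - z1^2) + beta (z + z2).
   The first summand is at least b^2, because
   a^2 + b^2 + 2 a b z1 - b^2 (1 - z1^2) = (a + b z1)^2; the second one is at
   least -2 beta > -(9/10) b^2.  So F > b^2 / 10, and the period is at most
   2 sqrt 10 L, where L = R I3 gamma (alpha + 1 - gamma) / b, times the
   integral of 1 / sqrt ((z - z1) (z2 - z)), which is pi.
   Finally sqrt 10 < 136/43 and pi < 52/15 give 2 sqrt 10 pi < 21.95. *)
Require Import Defs.
From HB Require Import structures.
From mathcomp Require Import all_boot all_order all_algebra.
From mathcomp Require Import all_classical all_reals all_analysis.
From mathcomp Require Import measurable_realfun.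
From mathcomp Require Import ring lra.
Set Implicit Arguments.
Unset Strict Implicit.
Unset Printing Implicit Defensive.
Import Order.TTheory GRing.Theory Num.Theory.
Import numFieldNormedType.Exports.
Local Open Scope classical_set_scope.
Local Open Scope ring_scope.

(* The Leibniz series truncated after three terms: 4 (1 - 1/3 + 1/5). *)
Lemma pi_le_leibniz (K : realType) : pi <= 52 / 15 :> K.
Proof.
pose F (x : K) := x - 3^-1 * x ^+ 3 + 5^-1 * x ^+ 5 - atan x.
(* Finite geometric sum: 1 - x^2 + x^4 - 1 / (1 + x^2) = x^6 / (1 + x^2), so [F] is nondecreasing on
   [0, 1]. *)
have dF (x : K) : is_derive x 1 F (x ^+ 6 / (1 + x ^+ 2)).
  apply: is_derive_eq.
  have x0 : 1 + x ^+ 2 != 0 by rewrite gt_eqF// ltr_pwDl// sqr_ge0.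
  rewrite !scaler1 /GRing.scale /=.
  by field.
have : F 0 <= F 1.
  apply: (@ger0_derive1_ndecr K F 0 1) => //.
  - move=> x _; rewrite derive1E derive_val.
    by rewrite divr_ge0 ?exprn_even_ge0// addr_ge0// sqr_ge0.
  - by apply: derivable_within_continuous.
rewrite /F atan0 atan1 !expr0n/= !expr1n; lra.
Qed.

(** * Improper integrals over a bounded open interval *)

(** Allows [f] to blow up at both ends: the fundamental theorem of calculus is applied on compact
    intervals exhausting the open one, and monotone convergence passes to the limit. Bounding the
    increments of [F] by [M] avoids any limit of [F] at [a] or [b]. *)
Lemma ge0_integral_itvoo_le (K : realType) (f F : K -> K) (a b M : K) :
  a < b ->
  (forall x, a < x < b -> 0 <= f x) ->
  (forall x, a < x < b -> {for x, continuous f}) ->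
  (forall x : K, a < x < b -> is_derive x 1 F (f x)) ->
  (forall x y, a < x < b -> a < y < b -> F y - F x <= M) ->
  (\int[lebesgue_measure]_(x in `]a, b[) (f x)%:E <= M%:E)%E.
Proof.
move=> ab f0 cf dF FM.
(* Starting the denominators at 3 keeps 2 [d n] < b - a, so that even the first [A n] is
   nondegenerate. *)
pose d n : K := (b - a) / n.+3%:R.
have ba : 0 < b - a by rewrite subr_gt0.
have d0 n : 0 < d n by rewrite divr_gt0.
have d3 n : d n <= (b - a) / 3.
  by rewrite ler_pM2l// lef_pV2 ?posrE// ler_nat.
have dS n : d n.+1 <= d n.
  by rewrite ler_pM2l// lef_pV2 ?posrE// ler_nat.
pose A n : set K := `[a + d n, b - d n]%classic.
have inA n x : A n x -> a < x < b.
  rewrite /A/= in_itv/= => /andP[ax xb].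
  by have := d0 n; lra.
have mfoo : measurable_fun (`]a, b[%classic : set K) (fun x => (f x)%:E).
  apply/measurable_EFinP; apply: open_continuous_measurable_fun => //.
  by move=> x; rewrite inE/= in_itv/=; exact: cf.
have -> : `]a, b[%classic = \bigcup_n A n.
  apply/seteqP; split => [x /=|x [n _ /inA]]; last by rewrite /= in_itv.
  rewrite in_itv/= => /andP[ax xb].
  have m0 : 0 < Num.min (x - a) (b - x) by rewrite lt_min !subr_gt0 ax xb.
  (* Archimedean choice of [n], making [d n] at most the distance from [x] to the nearer
     endpoint. *)
  set n := Num.bound ((b - a) / Num.min (x - a) (b - x)).
  have nP : (b - a) / Num.min (x - a) (b - x) < n.+3%:R.
    apply: lt_le_trans (archi_boundP _) _; first by rewrite divr_ge0 ?ltW.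
    by rewrite ler_nat -addn3 leq_addr.
  have : d n <= Num.min (x - a) (b - x).
    by rewrite ler_pdivrMr// mulrC -ler_pdivrMr// ltW.
  rewrite le_min => /andP[? ?]; exists n => //.
  by rewrite /A/= in_itv/=; apply/andP; split; lra.
have ndA : nondecreasing_seq A.
  apply/nondecreasing_seqP => n; rewrite subsetEset => x.
  rewrite /A/= !in_itv/= => /andP[ax xb].
  by have dn := dS n; apply/andP; split; lra.
have mA n : measurable (A n) by exact: measurable_itv.
have mfA n : measurable_fun (A n) (fun x => (f x)%:E).
  apply: measurable_funS mfoo => //.
  by move=> x /inA; rewrite /= in_itv.
have fA0 n x : A n x -> (0 <= (fun x => (f x)%:E) x)%E.
  by move=> /inA ?; rewrite lee_fin f0.
have cvgA :=
  ge0_nondecreasing_set_cvg_integral (mu := lebesgue_measure) ndA mA mfA fA0.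
rewrite -(cvg_lim _ cvgA)//; apply: lime_le.
  by apply/cvg_ex; eexists; exact: cvgA.
apply: nearW => n.
have dn : a + d n < b - d n by have := d3 n; have := d0 n; lra.
have cF : {within `[a + d n, b - d n], continuous F}.
  by apply: derivable_within_continuous => x /(inA n)/dF.
rewrite (@continuous_FTC2 _ f F)//; last 3 first.
- by apply: continuous_in_subspaceT => x /set_mem/inA; exact: cf.
- split; [|by move/(continuous_within_itvP _ dn): cF => -[]..].
  move=> x /subset_itv_oo_cc /(inA n)/dF//.
- move=> x /subset_itv_oo_cc /(inA n)/dF ?; by rewrite derive1E derive_val.
by rewrite -EFinB lee_fin; apply: FM; have := d3 n; have := d0 n; lra.
Qed.

(** An antiderivative is asin after the affine map [u] of ]a, b[ onto ]-1, 1[, and the values of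
    asin lie in an interval of length pi. *)
Lemma integral_invsqrt_le_pi (K : realType) (a b : K) : a < b ->
  (\int[lebesgue_measure]_(x in `]a, b[)
     ((Num.sqrt ((x - a) * (b - x)))^-1)%:E <= pi%:E)%E.
Proof.
move=> ab; have ba : 0 < b - a by rewrite subr_gt0.
pose u (x : K) := (2 * x - (a + b)) / (b - a).
have u1 x : a < x < b -> -1 < u x < 1.
  move=> /andP[? ?]; rewrite /u ltr_pdivlMr// ltr_pdivrMr//.
  by apply/andP; split; lra.
have w0 x : a < x < b -> 0 < (x - a) * (b - x).
  by move=> /andP[? ?]; rewrite mulr_gt0// subr_gt0.
apply: (@ge0_integral_itvoo_le _ (fun x => (Num.sqrt ((x - a) * (b - x)))^-1)
  (asin \o u)) => //.
- move=> x /w0 x0; apply: cvgV; first by rewrite sqrtr_eq0 -ltNge.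
  apply: continuous_comp; last exact: sqrt_continuous.
  by apply: cvgM; apply: cvgB => //; exact: cvg_cst.
- move=> x xab; have dasin := is_derive1_asin (u1 x xab).
  have du : is_derive x 1 u (2 / (b - a)).
    by rewrite /u; apply: is_derive_eq; rewrite /GRing.scale /=; field;
      rewrite gt_eqF.
  apply: is_derive_eq.
  (* The square root of the first factor is the slope of [u], which cancels the chain-rule
     factor. *)
  have -> : 1 - u x ^+ 2 = (2 / (b - a)) ^+ 2 * ((x - a) * (b - x)).
    by rewrite /u; field; rewrite gt_eqF.
  rewrite sqrtrM ?sqr_ge0// sqrtr_sqr ger0_norm ?divr_ge0 ?(ltW ba)//.
  by rewrite invfM mulrAC mulVf ?mul1r// gt_eqF// divr_gt0.
- move=> x y /u1/andP[x1 x2] /u1/andP[y1 y2].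
  have xu : -1 <= u x <= 1 by rewrite !ltW.
  have yu : -1 <= u y <= 1 by rewrite !ltW.
  by have := asin_geNpi2 xu; have := asin_lepi2 yu; rewrite /=; lra.
Qed.

(** * Algebra and comparison for the radicand *)

(** The root [z1] determines [e], so the cofactor is expressed through [z1] and [z2] alone, without
    the third root. *)
Lemma cubic_factor (K : fieldType) (e s a b z1 z2 z : K)
    (Q := fun t => (1 - t ^+ 2) * (e + s * t) - (b + a * t) ^+ 2) :
  z1 != z2 -> 1 - z1 ^+ 2 != 0 -> Q z1 = 0 -> Q z2 = 0 ->
  Q z = (z - z1) * (z2 - z) *
        ((a ^+ 2 + b ^+ 2 + 2 * a * b * z1) / (1 - z1 ^+ 2) + s * (z + z2)).
Proof.
rewrite /Q => z12 n1 Q1 Q2.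
(* [q] is the quotient of the cubic by t - z1 once [e] is eliminated; since q z2 = 0, the difference
   q z - q z2 exhibits the factor z2 - z. *)
pose q t := s * (1 - t ^+ 2)
  - ((a ^+ 2 + b ^+ 2) * (t + z1) + 2 * a * b * (1 + t * z1)) / (1 - z1 ^+ 2).
have eE : e = (b + a * z1) ^+ 2 / (1 - z1 ^+ 2) - s * z1.
  apply: (mulfI n1); move/eqP: Q1; rewrite subr_eq0 => /eqP.
  by rewrite mulrDr => Q1; rewrite mulrBr mulrCA mulfV// mulr1 -Q1; ring.
have Qq t : (1 - t ^+ 2) * (e + s * t) - (b + a * t) ^+ 2 = (t - z1) * q t.
  by rewrite eE /q; field.
have q2 : q z2 = 0.
  by move/eqP: Q2; rewrite Qq mulf_eq0 subr_eq0 eq_sym (negPf z12)/= => /eqP.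
rewrite Qq -mulrA; congr (_ * _); rewrite -[LHS]subr0 -q2 /q.
by field.
Qed.

(** Splits off the singular factor [w], leaving an inequality free of square roots to check. *)
Lemma divr_sqrt_le (K : rcfType) (g w f n c : K) :
  0 < w -> 0 < f -> 0 < n -> 0 < c -> g * n <= c ^+ 2 * f ->
  Num.sqrt g / Num.sqrt (w * f / n) <= c * (Num.sqrt w)^-1.
Proof.
move=> w0 f0 n0 c0 gn.
have wfn : 0 < w * f / n by rewrite divr_gt0// mulr_gt0.
rewrite ler_pdivrMr ?sqrtr_gt0// -[w * f / n]mulrA sqrtrM ?(ltW w0)//.
rewrite mulrA mulfVK ?gt_eqF ?sqrtr_gt0//.
rewrite -[c](gtr0_norm c0) -sqrtr_sqr -sqrtrM ?sqr_ge0//.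
by apply: ler_wsqrtr; rewrite mulrA ler_pdivlMr.
Qed.

(** * Coefficients, potential and [gfun] of the tippe top *)

(** [bcoef] increases with D, and at D = D1 it equals alpha lambda gamma / (1 + alpha) > 0. *)
Lemma bcoef_gt0 (K : realType) (p : tippe_top K) (D lambda : K) :
  0 < toprad p -> 0 < alpha p -> 0 < gamma p -> 0 < kappa p -> 0 < lambda ->
  D1 p lambda < D -> 0 < bcoef p D lambda.
Proof.
move=> R0 al0 ga0 k0 l0; rewrite /D1 /bcoef.
have : 0 < Num.sqrt (kappa p) by rewrite sqrtr_gt0.
move: (Num.sqrt _) => k k_gt0.
have a1 : 0 < 1 + alpha p by rewrite addr_gt0.
have -> : lambda / (toprad p * (1 + alpha p)) * ((alpha p + 1 - gamma p) / k) =
    lambda * (alpha p + 1 - gamma p) / (toprad p * (1 + alpha p) * k).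
  by field; rewrite !gt_eqF.
rewrite -mulNr ltr_pdivrMr ?mulr_gt0// => DK.
have lg : 0 < lambda * gamma p by rewrite mulr_gt0.
have -> : alpha p * lambda + alpha p * toprad p * D * k =
  alpha p * (lambda + D * (toprad p * (1 + alpha p) * k) / (1 + alpha p)).
  by field; rewrite gt_eqF.
by rewrite mulr_gt0// -ltrBlDl sub0r ltr_pdivlMr//; lra.
Qed.

Lemma effective_potential_cubic (K : realType) (p : tippe_top K)
    (D lambda E : K) :
  toprad p != 0 -> I3 p != 0 -> gamma p != 0 -> kappa p != 0 ->
  exists e, forall z, 1 - z ^+ 2 != 0 ->
    2 * I3 p * toprad p ^+ 2 * gamma p ^+ 2 * kappa p
      * ((1 - z ^+ 2) * (E - V p z D lambda)) =
    (1 - z ^+ 2) * (e + beta p * z)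
      - (bcoef p D lambda + acoef p D lambda * z) ^+ 2.
Proof.
move=> R0 i30 g0 k0; rewrite /V.
set cst := _ / (2 * _ ^+ 2 * I1 p * kappa p).
(* [e] collects the terms independent of z; gravity supplies beta z, and the squared numerator in
   [V] is exactly b + a z. *)
exists (2 * I3 p * toprad p ^+ 2 * gamma p ^+ 2 * kappa p
        * (E - mass p * grav p * toprad p - cst)) => z z1.
rewrite /beta /bcoef /acoef.
move: cst (Num.sqrt (kappa p)) => cst s.
move: (gamma p) (kappa p) g0 k0 => ga ka ga0 ka0.
by field; rewrite ?mulf_neq0 ?expf_neq0 //; do ?[apply/andP; split].
Qed.

(** [gfun] decreases in z; the bound is its value at z = -1. *)
Lemma gfun_le (K : realType) (p : tippe_top K) (z : K) :
  0 < I3 p -> 0 < alpha p -> gamma p < 1 -> 0 < kappa p -> -1 < z ->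
  gfun p z <= I3 p * (alpha p + 1 - gamma p) ^+ 2 / (2 * kappa p).
Proof.
move=> i30 al0 g1 k0 z1; rewrite /gfun ler_pM2r ?invr_gt0 ?mulr_gt0//.
rewrite ler_pM2l// -subr_ge0.
have -> : (alpha p + 1 - gamma p) ^+ 2
    - (alpha p ^+ 2 + (1 - gamma p) ^+ 2 - 2 * alpha p * (1 - gamma p) * z)
  = 2 * alpha p * (1 - gamma p) * (1 + z) by ring.
by rewrite !mulr_ge0// ?ltW//; lra.
Qed.

(** At z = 1 the bracket is the square of alpha - (1 - gamma), and it grows as z decreases. *)
Lemma gfun_gt0 (K : realType) (p : tippe_top K) (z : K) :
  0 < I3 p -> 0 < alpha p -> gamma p < 1 -> 0 < kappa p -> z < 1 ->
  0 < gfun p z.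
Proof.
move=> i30 al0 g1 k0 z1.
rewrite /gfun divr_gt0 ?mulr_gt0//.
have -> : alpha p ^+ 2 + (1 - gamma p) ^+ 2 - 2 * alpha p * (1 - gamma p) * z
  = (alpha p - (1 - gamma p)) ^+ 2 + 2 * alpha p * (1 - gamma p) * (1 - z).
  by ring.
by rewrite ltr_wpDl ?sqr_ge0// !mulr_gt0// subr_gt0.
Qed.

(** * The bound on the period *)

Theorem proposition4 (K : realType) (p : tippe_top K)
    (C lambda D E zmin z1 z2 : K)
    (m_gt0 : 0 < mass p) (g_gt0 : 0 < grav p) (R_gt0 : 0 < toprad p)
    (I1_gt0 : 0 < I1 p) (I3_gt0 : 0 < I3 p)
    (alpha_gt0 : 0 < alpha p) (alpha_lt1 : alpha p < 1)
    (gamma_gt : 1 - alpha p ^+ 2 < gamma p) (gamma_lt1 : gamma p < 1)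
    (sigmaE : sigma p = (1 - gamma p) / (gamma p + alpha p ^+ 2 - 1))
    (lambda_gt0 : 0 < lambda)
    (C_gt1 : 1 < C) (lambdaE : lambda = C * lambda_thres p)
    (D_gt : D1 p lambda < D) (D_lt : D < D0 p lambda)
    (zminP : is_minimum_point p D lambda zmin)
    (E_gt : V p zmin D lambda < E)
    (z12P : turning_points p D lambda E z1 z2)
    (z1wP : R_delta (10 ^- 4) (z1, wcoef p D lambda))
    (eps_lt : epsilon p D lambda < 9 / 10) :
  20 * beta p / 9 < bcoef p D lambda ^+ 2 /\
  (period p D lambda E z1 z2
     < (2195 / 100 * (toprad p * I3 p * gamma p * (alpha p + 1 - gamma p)
                      / bcoef p D lambda))%:E)%E.
Proof.
have ga_gt0 : 0 < gamma p by rewrite /gamma divr_gt0.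
have k_gt0 : 0 < kappa p by rewrite /kappa; lra.
have b_gt0 := bcoef_gt0 R_gt0 alpha_gt0 ga_gt0 k_gt0 lambda_gt0 D_gt.
have be_gt0 : 0 < beta p.
  rewrite /beta; move: (gamma p) (kappa p) ga_gt0 k_gt0 => ga ka ga0 ka0.
  by rewrite !mulr_gt0 ?exprn_gt0.
have be_lt : 20 * beta p / 9 < bcoef p D lambda ^+ 2.
  by move: eps_lt; rewrite /epsilon ltr_pdivrMr ?exprn_gt0//; lra.
split=> //.
case: z12P => z1_gt z12 z2_lt turn.
pose N := 2 * I3 p * toprad p ^+ 2 * gamma p ^+ 2 * kappa p.
have N_gt0 : 0 < N.
  rewrite /N; move: (gamma p) (kappa p) ga_gt0 k_gt0 => ga ka ga0 ka0.
  by rewrite !mulr_gt0 ?exprn_gt0.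
have sq_lt1 (z : K) : -1 < z < 1 -> 0 < 1 - z ^+ 2.
  by move=> /andP[? ?]; rewrite -[1](expr1n _ 2) subr_sqr;
    rewrite mulr_gt0 ?subr_gt0//; lra.
have [e VQ] : exists e, forall z, -1 < z < 1 ->
    N * ((1 - z ^+ 2) * (E - V p z D lambda)) =
    (1 - z ^+ 2) * (e + beta p * z)
      - (bcoef p D lambda + acoef p D lambda * z) ^+ 2.
  have [|||| e eP] := @effective_potential_cubic K p D lambda E;
    rewrite ?gt_eqF//.
  by exists e => z /sq_lt1 z0; rewrite eP// gt_eqF.
move: VQ be_lt b_gt0; set b := bcoef p D lambda; set a := acoef p D lambda.
move=> VQ be_lt b_gt0.
have iz1 : -1 < z1 < 1 by rewrite z1_gt (lt_trans z12).
have iz2 : -1 < z2 < 1 by rewrite z2_lt andbT (lt_trans _ z12).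
have iz (z : K) : z1 < z < z2 -> -1 < z < 1.
  by move=> /andP[? ?]; apply/andP; split; lra.
have Vz1 : E = V p z1 D lambda by apply/turn => //; left.
have Vz2 : E = V p z2 D lambda by apply/turn => //; right.
pose F (z : K) := (a ^+ 2 + b ^+ 2 + 2 * a * b * z1) / (1 - z1 ^+ 2)
            + beta p * (z + z2).
have VF (z : K) : z1 < z < z2 ->
    (1 - z ^+ 2) * (E - V p z D lambda) = (z - z1) * (z2 - z) * F z / N.
  have N0 : N != 0 by rewrite gt_eqF.
  move=> zz; apply: (mulfI N0).
  rewrite VQ ?iz// mulrCA mulfV ?gt_eqF// mulr1.
  apply: cubic_factor; first by rewrite lt_eqF.
  - by rewrite gt_eqF// sq_lt1.
  - by rewrite -VQ// -Vz1 subrr !mulr0.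
  - by rewrite -VQ// -Vz2 subrr !mulr0.
have F_gt (z : K) : z1 < z < z2 -> b ^+ 2 / 10 < F z.
  move=> /andP[? ?].
  have : b ^+ 2 <= (a ^+ 2 + b ^+ 2 + 2 * a * b * z1) / (1 - z1 ^+ 2).
    rewrite ler_pdivlMr ?sq_lt1// -subr_ge0.
    by have := sqr_ge0 (a + b * z1); congr (_ <= _); ring.
  have : 0 <= beta p * (z + z2 + 2) by rewrite mulr_ge0 ?ltW//; lra.
  rewrite /F; lra.
have w_gt0 (z : K) : z1 < z < z2 -> 0 < (z - z1) * (z2 - z).
  by move=> /andP[? ?]; rewrite mulr_gt0// subr_gt0.
have F_gt0 (z : K) : z1 < z < z2 -> 0 < F z.
  by move=> /F_gt; apply: le_lt_trans; rewrite divr_ge0 ?sqr_ge0.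
have al1 : 0 < alpha p + 1 - gamma p by lra.
set L := toprad p * I3 p * gamma p * (alpha p + 1 - gamma p) / b.
have L_gt0 : 0 < L.
  rewrite /L divr_gt0//; move: (gamma p) ga_gt0 al1 => ga ga0 al1.
  by rewrite !mulr_gt0.
have c_gt0 : 0 < 136 / 43 * L by rewrite mulr_gt0//; lra.
have bound (z : K) : z1 < z < z2 ->
    Num.sqrt (gfun p z) / Num.sqrt ((1 - z ^+ 2) * (E - V p z D lambda))
    <= (136 / 43 * L) * (Num.sqrt ((z - z1) * (z2 - z)))^-1.
  move=> zz; have /andP[z_gt z_lt] := iz z zz.
  rewrite VF//; apply: divr_sqrt_le => //; [exact: w_gt0|exact: F_gt0|].
  (* b^2 L^2 is exactly [N] times the bound of [gfun_le], kappa cancelling. Then b^2 < 10 F and 10 <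
     (136/43)^2 = 18496/1849 finish the estimate. *)
  apply: (@le_trans _ _ (b ^+ 2 * L ^+ 2)).
    apply: le_trans (ler_wpM2r (ltW N_gt0) (gfun_le _ _ _ _ z_gt)) _ => //.
    rewrite /N /L le_eqVlt; apply/predU1P; left.
    move: (gamma p) (kappa p) k_gt0 => ga ka ka0.
    by field; rewrite !gt_eqF.
  apply: (@le_trans _ _ (10 * L ^+ 2 * F z)).
    rewrite [leRHS]mulrAC ler_pM2r ?exprn_gt0// mulrC -ler_pdivrMr//.
    exact/ltW/F_gt.
  by rewrite ler_pM2r ?F_gt0// [leRHS]exprMn ler_pM2r ?exprn_gt0//; lra.
have mf : measurable_fun (`]z1, z2[%classic : set K) (fun z =>
    Num.sqrt (gfun p z) / Num.sqrt ((1 - z ^+ 2) * (E - V p z D lambda))).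
  (* In factored form the radicand of the denominator is visibly continuous and positive on ]z1,
     z2[. *)
  apply: (@eq_measurable_fun _ _ _ _ _ (fun z =>
    Num.sqrt (gfun p z) / Num.sqrt ((z - z1) * (z2 - z) * F z / N))).
    by move=> z; rewrite inE/= in_itv/= => /VF ->.
  apply: open_continuous_measurable_fun => // z.
  rewrite inE/= in_itv/= => zz; apply: cvgM.
    apply: continuous_comp; last exact: sqrt_continuous.
    by apply/differentiable_continuous/derivable1_diffP; rewrite /gfun.
  apply: cvgV.
    by rewrite sqrtr_eq0 -ltNge divr_gt0// mulr_gt0 ?w_gt0 ?F_gt0.
  apply: continuous_comp; last exact: sqrt_continuous.
  by apply/differentiable_continuous/derivable1_diffP; rewrite /F.
rewrite /period.
have I_le : (\int[lebesgue_measure]_(z in `]z1, z2[)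
     (Num.sqrt (gfun p z)
      / Num.sqrt ((1 - z ^+ 2) * (E - V p z D lambda)))%:E <=
   (136 / 43 * L)%:E * pi%:E)%E.
  have mw : measurable_fun (`]z1, z2[%classic : set K) (fun z =>
      (Num.sqrt ((z - z1) * (z2 - z)))^-1).
    apply: open_continuous_measurable_fun => // z.
    rewrite inE/= in_itv/= => zz; apply: cvgV.
      by rewrite sqrtr_eq0 -ltNge w_gt0.
    apply: continuous_comp; last exact: sqrt_continuous.
    exact/differentiable_continuous/derivable1_diffP.
  have c0 := ltW c_gt0.
  apply: (@le_trans _ _ (\int[lebesgue_measure]_(z in `]z1, z2[)
     ((136 / 43 * L)%:E * ((Num.sqrt ((z - z1) * (z2 - z)))^-1)%:E))%E).
    apply: ge0_le_integral => //.
    - exact/measurable_EFinP.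
    - by apply/measurable_EFinP; apply: measurable_funM => //;
        exact: measurable_cst.
  rewrite ge0_integralZl_EFin//.
  - by apply: lee_wpmul2l; rewrite ?lee_fin//; exact: integral_invsqrt_le_pi.
  - exact/measurable_EFinP.
apply: (@le_lt_trans _ _ (2%:E * ((136 / 43 * L)%:E * pi%:E))%E).
  by rewrite lee_pmul2l.
rewrite -!EFinM lte_fin.
(* Strictness comes only from the numbers: 2 (136/43) (52/15) = 14144/645 < 21.93, below 21.95. *)
have : L * pi <= L * (52 / 15) by rewrite ler_pM2l// pi_le_leibniz.
lra.
Qed.
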